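(* Let $W_2\ge 0$, $W_1>W_2$, $c_1\ge 0$, $x_{1_{\max}}>0$, $r\ge 1$, and define $\bar c_1 = \frac{c_1}{W_1-W_2}$ and $$x_{\text{threshold}} = x_{1_{\max}}\sqrt[r]{\frac{1}{1+\bar c_1}}.$$ Suppose Player 2 has successfully invested an effort $x_2\ge 0$. Then Player 1's expected utility $x\mapsto E[u_1(x)]$ over $x\ge 0$ (defined in the context, and depending on $x_2$) is maximized at $$x_1^*=\begin{cases} x_2, & x_2<x_{\text{threshold}},\\ 0, & \text{otherwise.}\end{cases}$$
   Context: Two-player sequential contest. Player 2 (leader) moves first, attempting an effort $x_2\ge 0$; Player 1 (follower) observes the outcome and then attempts an effort $x\ge 0$. The winner receives $W_1$ and the loser receives $W_2$, with $W_1>W_2\ge 0$; Player 1 pays a cost $c_1\ge 0$ if Player 1 fails. The player who successfully invests more effort wins, with ties broken in favor of Player 1. Player 1's probability of failing to achieve an attempted effort $x\ge 0$ is $$f_1(x)=\begin{cases}\left(\frac{x}{x_{1_{\max}}}\right)^r, & 0\le x<x_{1_{\max}},\\ 1, & x\ge x_{1_{\max}},\end{cases}$$ where $x_{1_{\max}}>0$ and $r\ge 1$ are real. Given that Player 2 has successfully invested $x_2$, Player 1's expected utility from attempting effort $x$ is $$E[u_1(x)]=\begin{cases} W_2-c_1f_1(x), & 0\le x<x_2,\\ W_1(1-f_1(x))+(W_2-c_1)f_1(x), & x\ge x_2.\end{cases}$$ *)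

(* Defs.v *)
From mathcomp Require Import all_boot all_order all_algebra.
From mathcomp Require Import all_classical all_reals all_analysis.

Set Implicit Arguments.
Unset Strict Implicit.
Unset Printing Implicit Defensive.

Import Order.TTheory GRing.Theory Num.Theory.
Local Open Scope ring_scope.

(* Efforts are nonnegative reals; the functions below are total on [R], and
   their values at negative efforts carry no meaning. *)

(* [powR 0 r] is [0] for [r != 0], so an attempted effort of [0] never fails. *)
Definition fail_prob (R : realType) (x1max r x : R) : R :=
  if x < x1max then (x / x1max) `^ r else 1.

Definition expected_utility (R : realType) (W1 W2 c1 x1max r x2 x : R) : R :=
  if x < x2 then W2 - c1 * fail_prob x1max r x
  else W1 * (1 - fail_prob x1max r x) + (W2 - c1) * fail_prob x1max r x.

Definition cbar (R : realType) (W1 W2 c1 : R) : R := c1 / (W1 - W2).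

(* The root of real order [r] is the power of exponent [r^-1]. *)
Definition x_threshold (R : realType) (W1 W2 c1 x1max r : R) : R :=
  x1max * (1 / (1 + cbar W1 W2 c1)) `^ r^-1.

Definition x1_star (R : realType) (W1 W2 c1 x1max r x2 : R) : R :=
  if x2 < x_threshold W1 W2 c1 x1max r then x2 else 0.

(* Maximizers need not be unique. *)
Definition maximized_at (R : realType) (D : set R) (u : R -> R) (a : R) : Prop :=
  D a /\ forall x, D x -> u x <= u a.

(* Main.v *)
Require Import Defs.
From mathcomp Require Import all_boot all_order all_algebra.
From mathcomp Require Import all_classical all_reals all_analysis.
From mathcomp Require Import ring lra.
Import Order.TTheory GRing.Theory Num.Theory.
Local Open Scope classical_set_scope.
Local Open Scope ring_scope.

(** Once [x2] is on the table, an attempt below [x2] loses for certain, so it is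
    worth at most [W2]; an attempt of at least [x2] is worth
    [W1 - (W1 - W2 + c1) * fail_prob x], which decreases in [x] because the
    failure probability increases. The only candidates are therefore [x2], the
    cheapest winning effort, and the free effort [0], worth [W2] when it loses.
    Comparing these two values, trying to win pays exactly when
    [fail_prob x2 < (W1 - W2) / (W1 - W2 + c1)] (with indifference at equality),
    and [x_threshold] is the effort whose failure probability is this quantile,
    by [fail_prob_lt]. *)

Lemma ltr_powRr (R : realType) (r x y : R) :
  0 < r -> 0 <= x -> 0 <= y -> (x `^ r < y `^ r) = (x < y).
Proof.
move=> r0 x0 y0.
have mono := le_mono_in (gt0_ltr_powR r0).
by apply: (leW_mono_in mono); rewrite nnegrE.
Qed.

Lemma fail_prob_ge0 (R : realType) (m r x : R) : 0 <= fail_prob m r x.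
Proof. by rewrite /fail_prob; case: ifP => // _; exact: powR_ge0. Qed.

Lemma fail_prob0 (R : realType) (m r : R) :
  0 < m -> r != 0 -> fail_prob m r 0 = 0.
Proof. by move=> m0 r0; rewrite /fail_prob m0 mul0r powR0. Qed.

(** Below [m] the failure probability is an increasing function with values less than [1],
    inverted by the root of order [r]. For [q = 1] the equivalence survives
    although the function is constant from [m] on: there [m * 1 `^ r^-1 = m], and
    both sides say [x < m]. *)
Lemma fail_prob_lt (R : realType) (m r q x : R) :
  0 < m -> 0 < r -> 0 <= q <= 1 -> 0 <= x ->
  (fail_prob m r x < q) = (x < m * q `^ r^-1).
Proof.
move=> m0 r0 /andP[q0 q1] x0.
have rootK : (q `^ r^-1) `^ r = q by rewrite -powRrM mulVf ?gt_eqF ?powRr1.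
have root_le1 : q `^ r^-1 <= 1.
  have : q `^ r^-1 <= 1 `^ r^-1.
    by apply: ge0_ler_powR => //; rewrite ?invr_ge0 ?nnegrE // ltW.
  by rewrite powR1.
rewrite /fail_prob; case: (ltP x m) => [xm|mx].
  rewrite -[in LHS]rootK ltr_powRr ?powR_ge0 ?divr_ge0 ?(ltW m0) //.
  by rewrite ltr_pdivrMr // mulrC.
rewrite ltNge q1; apply/esym/negbTE; rewrite -leNgt.
by apply: le_trans mx; rewrite ger_pMr.
Qed.

Lemma fail_prob_homo (R : realType) (m r x y : R) :
  0 < m -> 0 < r -> 0 <= x -> x <= y -> fail_prob m r x <= fail_prob m r y.
Proof.
move=> m0 r0 x0 xy; have y0 := le_trans x0 xy.
have base0 (z : R) : 0 <= z -> z / m \is Num.nneg.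
  by move=> z0; rewrite nnegrE divr_ge0 // ltW.
rewrite /fail_prob; case: (ltP y m) => [ym|my].
  rewrite (le_lt_trans xy ym); apply: ge0_ler_powR; rewrite ?(ltW r0) ?base0 //.
  by rewrite ler_pM2r ?invr_gt0.
case: (ltP x m) => // xm.
have one_powR : 1 `^ r = 1 :> R by rewrite powR1.
rewrite -[leRHS]one_powR.
apply: ge0_ler_powR; rewrite ?(ltW r0) ?base0 ?nnegrE //.
by rewrite ler_pdivrMr // mul1r ltW.
Qed.

Lemma one_div_1D_cbar (R : realType) (W1 W2 c1 : R) :
  W2 < W1 -> 0 <= c1 ->
  1 / (1 + cbar W1 W2 c1) = (W1 - W2) / (W1 - W2 + c1).
Proof.
move=> hW hc; rewrite /cbar; field.
by apply/andP; split; apply/lt0r_neq0; lra.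
Qed.

Lemma expected_utility_lose (R : realType) (W1 W2 c1 m r x2 x : R) :
  0 <= c1 -> x < x2 -> expected_utility W1 W2 c1 m r x2 x <= W2.
Proof.
move=> hc hx; rewrite /expected_utility hx.
by rewrite gerBl mulr_ge0 ?fail_prob_ge0.
Qed.

Lemma expected_utility_win (R : realType) (W1 W2 c1 m r x2 x : R) :
  x2 <= x ->
  expected_utility W1 W2 c1 m r x2 x
    = W1 - (W1 - W2 + c1) * fail_prob m r x.
Proof. by move=> hx; rewrite /expected_utility ltNge hx /=; ring. Qed.

Lemma expected_utility_win_le (R : realType) (W1 W2 c1 m r x2 x : R) :
  W2 < W1 -> 0 <= c1 -> 0 < m -> 0 < r -> 0 <= x2 -> x2 <= x ->
  expected_utility W1 W2 c1 m r x2 x <= expected_utility W1 W2 c1 m r x2 x2.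
Proof.
move=> hW hc m0 r0 hx2 hx; rewrite !expected_utility_win // lerB //.
by apply: ler_wpM2l; [lra | exact: fail_prob_homo].
Qed.

(** The threshold is where the cheapest winning effort stops beating the
    losing payoff. *)
Lemma lt_x_threshold (R : realType) (W1 W2 c1 m r x2 : R) :
  W2 < W1 -> 0 <= c1 -> 0 < m -> 0 < r -> 0 <= x2 ->
  (x2 < x_threshold W1 W2 c1 m r)
    = (W2 < expected_utility W1 W2 c1 m r x2 x2).
Proof.
move=> hW hc m0 r0 hx2.
have D0 : 0 < W1 - W2 + c1 by lra.
rewrite /x_threshold one_div_1D_cbar // -fail_prob_lt //; last first.
  by rewrite divr_ge0 ?ler_pdivrMr //=; lra.
by rewrite expected_utility_win // ltr_pdivlMr // mulrC ltrBrDl -ltrBrDr.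
Qed.

Theorem theorem1 (R : realType) (W1 W2 c1 x1max r x2 : R)
  (hW2 : 0 <= W2) (hW : W2 < W1) (hc1 : 0 <= c1) (hx1max : 0 < x1max)
  (hr : 1 <= r) (hx2 : 0 <= x2) :
  maximized_at [set x : R | 0 <= x]
    (expected_utility W1 W2 c1 x1max r x2)
    (x1_star W1 W2 c1 x1max r x2).
Proof.
have r0 : 0 < r by lra.
have fail0 : fail_prob x1max r 0 = 0 by rewrite fail_prob0 // gt_eqF.
split; first by rewrite /x1_star; case: ifP => /=.
move=> x /= x0; rewrite /x1_star lt_x_threshold //.
case: ltP => [win_pays|win_loses].
  case: (ltP x x2) => hx; last exact: expected_utility_win_le.
  by apply: le_trans (ltW win_pays); exact: expected_utility_lose.
(* Effort [0] would win a tie at [x2 = 0] for sure, so [x2] must be positive. *)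
have x2_gt0 : 0 < x2.
  rewrite lt_neqAle hx2 andbT; apply/eqP => x2E; move: win_loses.
  by rewrite -x2E expected_utility_win // fail0; lra.
have -> : expected_utility W1 W2 c1 x1max r x2 0 = W2.
  by rewrite /expected_utility x2_gt0 fail0 mulr0 subr0.
case: (ltP x x2) => hx; first exact: expected_utility_lose.
by apply: le_trans win_loses; exact: expected_utility_win_le.
Qed.
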